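(* Let $(X,\rho)$ be a complete metric space and let $T:X\to X$ be a universal iterative contraction map with constant $k\in[0,1)$, with associated integers $N_z^z\in\mathbb{N}$ ($z\in X$). Let $x\in X$ and let $\alpha=\lim_{n\to\infty}T^nx$. Define the sequence $\{p_n\}_{n=0}^\infty\subseteq\mathbb{N}_0$ by $p_0=0$ and $p_{n+1}=p_n+N_{T^{p_n}x}^{T^{p_n}x}$ for $n\in\mathbb{N}_0$, and let $$M_x=\max\left(\{\rho(x,T^{m}x):m\in\{1,2,\dots,N_x^x-1\}\}\cup\left\{\frac{1}{1-k}\rho(T^{N_x^x}x,x)\right\}\right).$$ Then for each $n\in\mathbb{N}_0$, $$\rho(\alpha,T^{p_n}x)\leq k^n M_x\quad\text{and}\quad \sup_{i\geq p_n}\rho(\alpha,T^ix)\leq 2k^n M_x.$$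
   Context: $\mathbb{N}$ denotes the set of positive integers, $\mathbb{N}_0=\mathbb{N}\cup\{0\}$, and $T^n$ denotes the $n$-fold composition of $T$ with itself ($T^0$ is the identity). Definition. Let $(X,\rho)$ be a metric space, $T:X\to X$ a mapping and $k\in[0,1)$. $T$ is called a universal iterative contraction map with constant $k$ if both of the following hold: - for any distinct points $x,y\in X$ there exists $N_y^x\in\mathbb{N}$ such that $\rho(T^{N_y^x}x,T^{N_y^x}y)\leq k\,\rho(x,y)$; - for each $x\in X$ there exists $N_x^x\in\mathbb{N}$ such that $\rho(T^{N_x^x}x,T^{N_x^x+n}x)\leq k\,\rho(x,T^nx)$ for every $n\in\mathbb{N}$. The integers $N_z^z$ in the claim are any fixed choice, for each $z\in X$, of integers satisfying the second condition. The limit $\alpha$ exists under the hypotheses of the claim. If $N_x^x=1$, the first set in the definition of $M_x$ is empty. *)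

(* Defs.v *)
From HB Require Import structures.
From mathcomp Require Import all_boot all_order all_algebra.
From mathcomp Require Import all_classical all_reals all_analysis.

Set Implicit Arguments.
Unset Strict Implicit.
Unset Printing Implicit Defensive.

Import Order.TTheory GRing.Theory Num.Theory.

Local Open Scope classical_set_scope.
Local Open Scope ring_scope.

(* [Complete] carries a distinguished point, needed only for [lim] to be a
   total function; every claim here concerns a given point of the space, so
   nonemptiness is no restriction. *)
#[short(type="completeMetricType")]
HB.structure Definition CompleteMetric (R : numDomainType) :=
  {X of Metric R X & Complete X}.

Section UniversalIterativeContraction.
Context {R : realType} {X : metricType R}.
Implicit Types (k : R) (T : X -> X) (x : X).

(* [N] is an admissible value of N_x^x. *)
Definition self_contraction_index k T x (N : nat) : Prop :=
  (0 < N)%N /\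
  forall n : nat, (0 < n)%N ->
    mdist (iter N T x) (iter (N + n) T x) <= k * mdist x (iter n T x).

Definition universal_iterative_contraction k T : Prop :=
  [/\ 0 <= k < 1,
      forall x y : X, x <> y ->
        exists N : nat, (0 < N)%N /\
          mdist (iter N T x) (iter N T y) <= k * mdist x y
    & forall x : X, exists N : nat, self_contraction_index k T x N].

Fixpoint contraction_time T (N : X -> nat) x (n : nat) : nat :=
  if n is m.+1 then
    let p := contraction_time T N x m in (p + N (iter p T x))%N
  else 0%N.

(* The base value of the iterated maximum is itself a member of the set whose
   maximum is taken, so this is the maximum of
   {rho(x, T^m x) : 1 <= m < N} U {rho(T^N x, x) / (1 - k)}. *)
Definition orbit_bound k T x (N : nat) : R :=
  \big[Num.max/(1 - k)^-1 * mdist (iter N T x) x]_(1 <= m < N)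
    mdist x (iter m T x).

End UniversalIterativeContraction.

(* Main.v *)
Require Import Defs.
From HB Require Import structures.
From mathcomp Require Import all_boot all_order all_algebra.
From mathcomp Require Import all_classical all_reals all_analysis.

(** Call a radius [r] good for a point [z] when every iterate of [z] lies
    within [r] of [z].  The argument follows one good radius along the times
    [p_n].

    The bound [M] is good for [x]: an iterate of index below [N_x] is within
    [M] by definition, and one of index [N_x + j] is reached through
    [T^{N_x} x], which costs at most [(1 - k) M] for the step from [x] to
    [T^{N_x} x] and [k M] for the rest, by the contraction property and
    induction on the index ([orbit_in_ball]).  The factor [(1 - k)^-1] in [M]
    is exactly what makes these two costs add up to [M].

    If [r] is good for [z], then the contraction property of [N_z] says that
    [k r] is good for [T^{N_z} z].  Iterating from [x], the radius [k^n M] is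
    good for [T^{p_n} x] ([tail_in_ball]).  Tails of the orbit thus lie in
    balls whose radii tend to [0], so the orbit converges by completeness
    ([cvg_orbit]).  The limit lies in every closed ball that contains a tail,
    which is the first estimate; the triangle inequality through [T^{p_n} x]
    gives the second one, with the factor [2]. *)

Set Implicit Arguments.
Unset Strict Implicit.
Unset Printing Implicit Defensive.

Import Order.TTheory GRing.Theory Num.Theory.

Local Open Scope classical_set_scope.
Local Open Scope ring_scope.

Section MetricLimit.
Context {R : realType} {X : metricType R}.

(** Closed balls are closed under limits; this transfers to the limit of the
    orbit the bounds known for its tails. *)
Lemma mdist_lim_le (u : nat -> X) (l z : X) (r : R) :
  u @ \oo --> l -> (\forall i \near \oo, mdist z (u i) <= r) ->
  mdist l z <= r.
Proof.
move=> ul zu; apply/ler_addgt0Pl => e e0; near \oo => i.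
rewrite (le_trans (metric_triangle _ (u i) _))// lerD//.
  by near: i; exact: metricType_numDomainType.cvgr_dist_le.
by rewrite metric_sym; near: i.
Unshelve. all: by end_near. Qed.

End MetricLimit.

Section OrbitEstimates.
Context {R : realType} {X : metricType R}.
Variables (k : R) (T : X -> X).
Hypothesis k01 : 0 <= k < 1.

Let k_ge0 : 0 <= k. Proof. by case/andP: k01. Qed.
Let k_lt1 : k < 1. Proof. by case/andP: k01. Qed.

Lemma mdist_orbit_bound_head (x : X) (N m : nat) : (0 < m < N)%N ->
  mdist x (iter m T x) <= orbit_bound k T x N.
Proof.
move=> mN; rewrite /orbit_bound.
by apply: (@le_bigmax_seq _ _ _ _ _ m xpredT) => //; rewrite mem_index_iota.
Qed.

Lemma mdist_orbit_bound_jump (x : X) (N : nat) :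
  mdist x (iter N T x) <= (1 - k) * orbit_bound k T x N.
Proof.
rewrite metric_sym mulrC -ler_pdivrMr ?subr_gt0// mulrC.
exact: bigmax_ge_id.
Qed.

Lemma orbit_bound_ge0 (x : X) (N : nat) : 0 <= orbit_bound k T x N.
Proof.
apply: le_trans (bigmax_ge_id _ _ _ _).
by rewrite mulr_ge0 ?mdist_ge0// invr_ge0 subr_ge0 ltW.
Qed.

(** An iterate of index [N + j] is compared with [T^N x]: the jump to [T^N x]
    uses up the fraction [1 - k] of the bound, and contraction reduces the
    remaining distance to [k] times that of the earlier iterate of index [j]. *)
Lemma orbit_in_ball (x : X) (N : nat) : self_contraction_index k T x N ->
  forall m, mdist x (iter m T x) <= orbit_bound k T x N.
Proof.
move=> [N0 xN]; elim/ltn_ind => m IH.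
have [->|m0] := posnP m; first by rewrite mdistxx orbit_bound_ge0.
have [mN|] := ltnP m N; first by rewrite mdist_orbit_bound_head ?m0.
(* Contraction is only assumed for positive shifts, so the index [N] itself is
   treated apart. *)
rewrite leq_eqVlt => /predU1P[<-|Nm].
  rewrite (le_trans (mdist_orbit_bound_jump _ _))// ler_piMl ?orbit_bound_ge0//.
  by rewrite lerBlDr lerDl.
rewrite (le_trans (metric_triangle _ (iter N T x) _))//.
rewrite -[leRHS]mul1r -[in leRHS](subrK k 1) mulrDl lerD//.
  exact: mdist_orbit_bound_jump.
rewrite -(subnKC (ltnW Nm)) (le_trans (xN _ _)) ?subn_gt0//.
by rewrite ler_wpM2l// IH// ltn_subrL N0.
Qed.

Variable N : X -> nat.
Hypothesis hN : forall z, self_contraction_index k T z (N z).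

(** Each passage from [p_n] to [p_{n+1}] applies the contraction property at
    the point [T^{p_n} x], uniformly over its whole forward orbit, and so
    multiplies the radius of the tail by [k]. *)
Lemma tail_in_ball (x : X) (n m : nat) :
  mdist (iter (contraction_time T N x n) T x)
        (iter (m + contraction_time T N x n) T x)
    <= k ^+ n * orbit_bound k T x (N x).
Proof.
elim: n m => [|n IH] m; first by rewrite addn0 mul1r; exact: orbit_in_ball.
rewrite /=; set p := contraction_time T N x n in IH *.
set z := iter p T x in IH *.
have [->|m0] := posnP m.
  by rewrite mdistxx mulr_ge0 ?exprn_ge0 ?orbit_bound_ge0.
have [_ zN] := hN z.
rewrite (addnC p) addnA (addnC m) !iterD -/z -iterD.
rewrite (le_trans (zN _ m0))// exprS -mulrA ler_wpM2l//.
by rewrite -iterD.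
Qed.

Lemma near_tail_in_ball (x : X) (n : nat) :
  \forall i \near \oo, mdist (iter (contraction_time T N x n) T x) (iter i T x)
    <= k ^+ n * orbit_bound k T x (N x).
Proof.
near=> i; rewrite -(@subnK (contraction_time T N x n) i) ?tail_in_ball//.
by near: i; exact: nbhs_infty_ge.
Unshelve. all: by end_near. Qed.

End OrbitEstimates.

Section OrbitConvergence.
Import numFieldNormedType.Exports.

(** The orbit is Cauchy because the balls of [tail_in_ball], each of which
    contains a tail, have radii [k^n M] tending to [0]. *)
Lemma cvg_orbit (R : realType) (X : completeMetricType R) (k : R) (T : X -> X)
    (N : X -> nat) (x : X) : 0 <= k < 1 ->
  (forall z, self_contraction_index k T z (N z)) ->
  cvgn (fun n => iter n T x).
Proof.
move=> k01 hN; apply: cauchy_cvg; apply: cauchy_exP => e e0.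
have radius0 : k ^+ n * orbit_bound k T x (N x) @[n --> \oo] --> (0 : R).
  rewrite -[X in _ --> X](mul0r (orbit_bound k T x (N x))).
  apply: cvgMr_tmp; apply: cvg_expr.
  by case/andP: k01 => k0 k1; rewrite ger0_norm.
have [n rn] : exists n, k ^+ n * orbit_bound k T x (N x) < e.
  have [n _ /(_ n (leqnn n))] := cvgr_lt _ radius0 _ e0.
  by exists n.
exists (iter (contraction_time T N x n) T x).
apply: filterS (near_tail_in_ball k01 hN x n) => i le_r.
by rewrite ballEmdist/=; exact: le_lt_trans rn.
Qed.

End OrbitConvergence.

Theorem theorem7 (R : realType) (X : completeMetricType R) (k : R)
    (T : X -> X) (N : X -> nat)
    (hT : universal_iterative_contraction k T)
    (hN : forall z : X, self_contraction_index k T z (N z))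
    (x : X) :
  let alpha : X := limn (fun n : nat => iter n T x) in
  let p : nat -> nat := contraction_time T N x in
  let M : R := orbit_bound k T x (N x) in
  forall n : nat,
    mdist alpha (iter (p n) T x) <= k ^+ n * M /\
    (ereal_sup [set (mdist alpha (iter i T x))%:E | i in [set i | (p n <= i)%N]]
       <= (2 * k ^+ n * M)%:E)%E.
Proof.
move=> alpha p M n; have [k01 _ _] := hT.
have alpha_p : mdist alpha (iter (p n) T x) <= k ^+ n * M.
  apply: mdist_lim_le (near_tail_in_ball k01 hN x n).
  exact: cvg_orbit k01 hN.
split=> //; apply: ge_ereal_sup => _ [i /= pi <-]; rewrite lee_fin.
rewrite (le_trans (metric_triangle _ (iter (p n) T x) _))//.
rewrite -mulrA mulr_natl mulr2n lerD//.
by rewrite -(subnK pi); exact: tail_in_ball.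
Qed.
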